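(* Let $q$ be an odd prime power with $q\equiv 3 \pmod 4$, and let $a,b,c\in F_q^\ast$ with $ab=c^2$. Write $C_1^n=\sum_{j\in F_q}\alpha_{n,j}C_j$ for the distribution after $n$ steps of the random walk by $C_1$ started at $C_0$. Then \[ \lim_{n\to\infty} C_1^n=\frac{1}{q^2}C_0+\frac{q+1}{q^2}\sum_{i\in F_q^\ast}C_i, \] i.e. $\alpha_{n,0}\to 1/q^2$ and $\alpha_{n,i}\to (q+1)/q^2$ for every $i\in F_q^\ast$ as $n\to\infty$. Furthermore, the mixing time of this random walk is linear in $q$: for every fixed $\varepsilon\in(0,1)$ there is a constant $M_\varepsilon$, depending only on $\varepsilon$, such that for all such $q,a,b$ the mixing time satisfies $\tau(\varepsilon)\le M_\varepsilon\, q$.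
   Context: $F_q$ is the finite field with $q$ elements and $F_q^\ast$ its set of non-zero elements. For $i\in F_q$ let $C_i=\{(x,y)\in F_q^2: ax^2+by^2=i\}$ (when $q\equiv 3 \pmod 4$ and $ab$ is a non-zero square, $C_0=\{(0,0)\}$). Let $N_{ij}^k$ be the number of pairs $(A,B)\in C_i\times C_j$ with $A+B\in C_k$, and $n_{ij}^k=N_{ij}^k/(|C_i||C_j|)$. Formal linear combinations of the $C_k$ are multiplied bilinearly by $C_iC_j=\sum_{k\in F_q} n_{ij}^kC_k$, and $C_1^n$ denotes the $n$-th power of $C_1$ in this sense; convergence is coefficientwise. The random walk by $C_1$ is the Markov chain on the set $\{C_i\}_{i\in F_q}$ with kernel $K(C_i,C_j)=n_{i1}^j$. Thus $\alpha_{n,j}=K^n(C_0,C_j)$. The total variation distance is $d_{\mathrm{TV}}(\mu,\nu)=\frac12\sum_x|\mu(x)-\nu(x)|$. With $\pi$ the stationary distribution of $K$, the mixing time is $\tau(\varepsilon)=\max_{x}\min\{t: d_{\mathrm{TV}}(K^t(x,\cdot),\pi)\le\varepsilon\}$, the maximum being over all states $x$. *)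

(* Defs.v *)
From mathcomp Require Import all_boot all_order all_algebra.
From mathcomp Require Import all_classical all_reals all_analysis.

Set Implicit Arguments.
Unset Strict Implicit.
Unset Printing Implicit Defensive.

Import Order.TTheory GRing.Theory Num.Theory.
Import numFieldNormedType.Exports.

Local Open Scope ring_scope.

Definition conic (F : finFieldType) (a b i : F) : {set F * F} :=
  [set P : F * F | a * P.1 ^+ 2 + b * P.2 ^+ 2 == i].

Definition conic_count (F : finFieldType) (a b i j k : F) : nat :=
  #|[set AB : (F * F) * (F * F) |
      [&& AB.1 \in conic a b i, AB.2 \in conic a b j
        & AB.1 + AB.2 \in conic a b k]]|.

Definition conic_coef (R : realType) (F : finFieldType) (a b i j k : F) : R :=
  (conic_count a b i j k)%:R / (#|conic a b i| * #|conic a b j|)%:R.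

(* A formal R-linear combination of the C_i is the family of its coefficients,
   so it lives in the R-module {ffun F -> R}; [Cbasis i] is C_i itself. *)
Definition Cbasis (R : realType) (F : finFieldType) (i : F) : {ffun F -> R} :=
  [ffun j => (j == i)%:R].

Definition Cmul (R : realType) (F : finFieldType) (a b : F)
    (u v : {ffun F -> R}) : {ffun F -> R} :=
  \sum_(i : F) \sum_(j : F)
    (u i * v j) *: \sum_(k : F) conic_coef R a b i j k *: Cbasis R k.

(* The empty product is C_0, which is the unit of the product when
   C_0 = {(0,0)}. *)
Definition Cpow (R : realType) (F : finFieldType) (a b : F)
    (u : {ffun F -> R}) (n : nat) : {ffun F -> R} :=
  iter n (fun v => Cmul a b v u) (Cbasis R 0).

Definition alpha (R : realType) (F : finFieldType) (a b : F) (n : nat) (j : F)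
  : R := Cpow a b (Cbasis R 1) n j.

Fixpoint kernel_pow (R : realType) (T : finType) (K : T -> T -> R) (n : nat)
    (x y : T) : R :=
  if n is m.+1 then \sum_(z : T) kernel_pow K m x z * K z y else (x == y)%:R.

Definition dTV (R : realType) (T : finType) (mu nu : T -> R) : R :=
  2^-1 * \sum_(x : T) `|mu x - nu x|.

Definition stationary (R : realType) (T : finType) (K : T -> T -> R)
    (pi : {ffun T -> R}) : Prop :=
  [/\ forall x, 0 <= pi x, \sum_(x : T) pi x = 1
    & forall y, \sum_(x : T) pi x * K x y = pi y].

(* The value is an extended real so that a state from which the distance never
   drops to eps contributes +oo (the infimum of the empty set); otherwise the
   infimum is the least such time. *)
Definition mixing_time (R : realType) (T : finType) (K : T -> T -> R)
    (pi : T -> R) (eps : R) : \bar R :=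
  \big[maxe/-oo%E]_(x : T)
    ereal_inf [set (t%:R)%:E | t in [set t : nat |
                                 dTV (kernel_pow K t x) pi <= eps]].

(* The state C_i is represented by its index i: in the case of interest the
   C_i are nonempty and pairwise disjoint, so i |-> C_i is injective. *)
Definition conic_walk (R : realType) (F : finFieldType) (a b : F) (i j : F)
  : R := conic_coef R a b i 1 j.

Lemma alphaE (R : realType) (F : finFieldType) (a b : F) (n : nat) (j : F) :
  alpha R a b n j = kernel_pow (conic_walk R a b) n 0 j.
Proof.
rewrite /alpha; elim: n j => [|n IHn] j /=; first by rewrite ffunE eq_sym.
rewrite /Cmul sum_ffunE; apply: eq_bigr => i _; rewrite -IHn sum_ffunE.
have CE k : (\sum_(l : F) conic_coef R a b i k l *: Cbasis R l) j
    = conic_coef R a b i k j.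
  rewrite sum_ffunE (bigD1 j) //= big1 => [|l /negPf lj].
    by rewrite !ffunE eqxx addr0 [LHS]mulr1.
  by rewrite !ffunE eq_sym lj [LHS]mulr0.
rewrite (eq_bigr (fun k => Cpow a b (Cbasis R 1) n i * (k == 1)%:R *
                           conic_coef R a b i k j)); last first.
  by move=> k _; rewrite ffunE CE [in LHS]ffunE.
rewrite (bigD1 1) //= big1 => [|k /negPf k1]; first by rewrite eqxx mulr1 addr0.
by rewrite k1 mulr0 mul0r.
Qed.

(* Main.v *)
(** Fix A on C_i with i <> 0.  The points B of C_1 with A + B in C_k lie on a
    line, so there are at most two of them and K(C_i, C_k) <= 2/(q+1).  Two
    probability vectors on q points with entries at most 2/(q+1) overlap in
    mass at least 2/(q+1), because min(s, t) >= s + t - 2/(q+1).  As every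
    state moves to a nonzero one with probability at least 1/2, K^2 contracts
    the l1 norm on vectors of sum zero by 1 - 1/(2(q+1)).  The vector
    |C_i|/q^2 is stationary because (A, B) |-> (A + B, B) is a bijection, and
    |C_i| = q+1 for i <> 0 because multiplication by u + v sqrt(-1) permutes
    the conics and every i is a sum of two squares.  The contraction gives
    d_TV(K^n(x, .), pi) <= 4(q+1)/(n+1) for every starting state x. *)
Require Import Defs.
From mathcomp Require Import all_boot all_order all_algebra all_field ring lra.
From mathcomp Require Import all_classical all_reals all_analysis.

Import Order.TTheory GRing.Theory Num.Theory.
Import numFieldNormedType.Exports.

Local Open Scope classical_set_scope.
Local Open Scope ring_scope.

(** * Squares in finite fields *)

(** Translation by 1 permutes the field, so adding 1 to each of the q summands leaves the sum of all
    elements unchanged. *)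
Lemma card_finField_eq0 (F : finFieldType) : #|F|%:R = 0 :> F.
Proof.
have : \sum_(x : F) (x + 1) = \sum_(x : F) x.
  by rewrite [RHS](reindex_inj (addIr 1)).
rewrite big_split /= sumr_const => /eqP.
by rewrite -subr_eq0 addrAC subrr add0r => /eqP.
Qed.

Lemma card_mod4_eq3_2neq0 (F : finFieldType) :
  (#|F| %% 4 = 3)%N -> 2 != 0 :> F.
Proof.
move=> F3; apply/eqP => F2.
have := card_finField_eq0 F; rewrite (divn_eq #|F| 4) F3 natrD natrM.
have -> : 4%:R = 0 :> F by rewrite (natrM _ 2 2) F2 mul0r.
have -> : 3%:R = 1 :> F by rewrite (natrD _ 2 1) F2 add0r.
by rewrite mulr0 add0r => /eqP; rewrite oner_eq0.
Qed.

(** If x^2 = -1 then x^4 = 1, so x^q = x^3 = -x. But x^q = x, which forces 2x = 0. *)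
Lemma card_mod4_eq3_sqr_neqN1 (F : finFieldType) (x : F) :
  (#|F| %% 4 = 3)%N -> x ^+ 2 != -1.
Proof.
move=> F3; apply/eqP => x2.
have : x ^+ #|F| = - x.
  rewrite (divn_eq #|F| 4) F3 exprD mulnC exprM.
  have -> : x ^+ 4 = 1 by rewrite (exprM _ 2 2) x2 sqrrN expr1n.
  by rewrite expr1n mul1r exprS x2 mulrN1.
rewrite expf_card => /eqP; rewrite -addr_eq0 -mulr2n -mulr_natl mulf_eq0.
rewrite (negPf (card_mod4_eq3_2neq0 _ F3)) /= => /eqP x0.
by move/eqP: x2; rewrite x0 expr0n /= eq_sym oppr_eq0 oner_eq0.
Qed.

Lemma sum_sqr_eq0 (F : finFieldType) (x y : F) :
  (#|F| %% 4 = 3)%N -> x ^+ 2 + y ^+ 2 = 0 -> x = 0 /\ y = 0.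
Proof.
move=> F3 xy0; have [y0|y0] := eqVneq y 0.
  by move/eqP: xy0; rewrite y0 expr0n /= addr0 sqrf_eq0 => /eqP.
have := card_mod4_eq3_sqr_neqN1 _ (x / y) F3; rewrite expr_div_n.
rewrite (_ : x ^+ 2 = - y ^+ 2) ?mulNr ?divff ?eqxx ?sqrf_eq0 //.
by apply/eqP; rewrite -addr_eq0 xy0.
Qed.

Lemma card_sqr_roots_le2 (F : finFieldType) (e : F) :
  (#|[set x : F | x ^+ 2 == e]%SET| <= 2)%N.
Proof.
have [->|[x xe]] := set_0Vmem [set x : F | x ^+ 2 == e]%SET.
  by rewrite cards0.
apply: leq_trans (_ : #|[set x; -x]%SET| <= 2)%N; last first.
  by rewrite cards2; case: (_ != _).
apply: subset_leq_card; apply/fintype.subsetP => y; rewrite !inE in xe *.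
by move/eqP: xe => <-; rewrite eqf_sqr.
Qed.

(** Squaring has one point over 0 and at most two over any other square, so q <= 1 + 2(|S| - 1) for
    the set S of squares. *)
Lemma card_sqr_image_ge (F : finFieldType) :
  (#|F|.+1 <= #|[set x ^+ 2 | x : F]%SET| * 2)%N.
Proof.
set S := [set _ | _ in _]%SET.
have S0 : 0 \in S by apply/imsetP; exists 0; rewrite ?expr0n.
rewrite (cardsD1 0) S0 mulnDl mul1n.
have -> : #|F| = (\sum_(s in S) #|[set x : F | x ^+ 2 == s]%SET|)%N.
  rewrite -sum1_card (partition_big (fun x : F => x ^+ 2) (mem S)) /=.
    by apply: eq_bigr => s _; rewrite sum1dep_card.
  by move=> x _; apply/imsetP; exists x.
rewrite (bigD1 0) //=.
have -> : [set x : F | x ^+ 2 == 0]%SET = [set 0]%SET.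
  by apply/setP => x; rewrite !inE sqrf_eq0.
rewrite cards1 add1n ltnS -addn1 addnC leq_add2l.
rewrite -sum_nat_const (eq_bigl (mem (S :\ 0)%SET)) => [|s]; last first.
  by rewrite !inE andbC.
by apply: leq_sum => s _; exact: card_sqr_roots_le2.
Qed.

(** Pigeonhole: S and i - S both contain more than half of the field, so they meet. *)
Lemma sum_two_sqr_surj (F : finFieldType) (i : F) :
  exists u v, u ^+ 2 + v ^+ 2 = i.
Proof.
set S := [set x ^+ 2 | x : F]%SET.
have [/eqP|[s]] := set_0Vmem (S :&: [set i - s | s in S])%SET; last first.
  rewrite !inE => /andP[/imsetP[u _ ->] /imsetP[_ /imsetP[v _ ->] e]].
  by exists u, v; rewrite e subrK.
rewrite -cards_eq0 => /eqP I0.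
have := cardsUI S [set i - s | s in S]%SET; rewrite I0 addn0.
rewrite (card_imset (mem S) (subrI i)).
move=> cU; have := max_card (mem (S :|: [set i - s | s in S])%SET).
by rewrite cU addnn -muln2 leqNgt card_sqr_image_ge.
Qed.

(** * Sizes of the conics and of their intersections with translates *)

Lemma card_conic_le_mul_sum_sqr (F : finFieldType) (a b c i u v : F) :
  a != 0 -> c != 0 -> a * b = c ^+ 2 -> u ^+ 2 + v ^+ 2 != 0 ->
  (#|conic a b i| <= #|conic a b ((u ^+ 2 + v ^+ 2) * i)%R|)%N.
Proof.
move=> a0 c0 abc n0.
have bE : b = c ^+ 2 / a by rewrite -abc; field.
(* In the coordinates (a x, c y), where the form is (X^2 + Y^2) / a, this is
   the multiplication by u + v sqrt(-1). *)
pose f u v (P : F * F) :=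
  (u * P.1 - c / a * v * P.2, a / c * v * P.1 + u * P.2).
have fK : cancel (f u v)
    (f (u / (u ^+ 2 + v ^+ 2)) (- v / (u ^+ 2 + v ^+ 2))).
  by move=> [x y]; rewrite /f /=; congr (_, _); field; rewrite n0 a0 c0.
rewrite -(card_imset _ (can_inj fK)).
apply: subset_leq_card; apply/fintype.subsetP => _ /imsetP[[x y] + ->].
rewrite !inE /= => /eqP <-; apply/eqP; rewrite bE; field.
by rewrite a0 c0.
Qed.

(** The multiplier i maps C_1 into C_i and the multiplier 1/i maps C_i into C_1. Both are sums of
    two squares. *)
Lemma card_conic_neq0 (F : finFieldType) (a b c i : F) :
  a != 0 -> c != 0 -> a * b = c ^+ 2 -> i != 0 ->
  #|conic a b i| = #|conic a b 1|.
Proof.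
move=> a0 c0 abc i0.
have [u [v uv]] := sum_two_sqr_surj _ i.
have [u' [v' uv']] := sum_two_sqr_surj _ i^-1.
apply/eqP; rewrite eqn_leq; apply/andP; split.
  have := card_conic_le_mul_sum_sqr _ a b c i u' v' a0 c0 abc.
  by rewrite uv' mulVf // invr_eq0 => ->.
have := card_conic_le_mul_sum_sqr _ a b c 1 u v a0 c0 abc.
by rewrite uv mulr1 => ->.
Qed.

(** Multiplied by a, the form becomes (a x)^2 + (c y)^2, which is anisotropic because -1 is not a
    square. *)
Lemma conic0 (F : finFieldType) (a b c : F) :
  (#|F| %% 4 = 3)%N -> a != 0 -> c != 0 -> a * b = c ^+ 2 ->
  conic a b 0 = [set (0, 0)]%SET.
Proof.
move=> F3 a0 c0 abc; apply/setP => -[x y]; rewrite !inE /=.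
apply/eqP/eqP => [e|[-> ->]]; last by rewrite expr0n /= !mulr0 addr0.
have [ax cy] : a * x = 0 /\ c * y = 0.
  apply: sum_sqr_eq0 => //; rewrite !exprMn -abc.
  by move: e => /(congr1 ( *%R a)); rewrite mulr0 => <-; ring.
move/eqP: ax; move/eqP: cy; rewrite !mulf_eq0 (negPf a0) (negPf c0) /=.
by move=> /eqP -> /eqP ->.
Qed.

Lemma sum_card_conic (F : finFieldType) (a b : F) :
  (\sum_i #|conic a b i| = #|F| ^ 2)%N.
Proof.
transitivity #|{: F * F}|; last by rewrite card_prod -mulnn.
rewrite -sum1_card (partition_big (fun P : F * F =>
  a * P.1 ^+ 2 + b * P.2 ^+ 2) xpredT) //=.
by apply: eq_bigr => i _; rewrite sum1dep_card.
Qed.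

Lemma card_conic (F : finFieldType) (a b c i : F) :
  (#|F| %% 4 = 3)%N -> a != 0 -> c != 0 -> a * b = c ^+ 2 ->
  #|conic a b i| = if i == 0 then 1%N else #|F|.+1.
Proof.
move=> F3 a0 c0 abc; have [->|i0] := eqVneq i 0.
  by rewrite (conic0 _ _ _ _ F3 a0 c0 abc) cards1.
rewrite (card_conic_neq0 _ _ _ _ _ a0 c0 abc i0).
have := sum_card_conic _ a b.
rewrite (bigD1 0) //= (conic0 _ _ _ _ F3 a0 c0 abc) cards1.
rewrite (eq_bigr (fun=> #|conic a b 1|)); last first.
  by move=> j; apply: card_conic_neq0 a0 c0 abc.
rewrite sum_nat_const (eq_card (B := predC1 (0 : F))) // cardC1.
have : (1 < #|F|)%N by rewrite finNzRing_gt1.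
case: #|F| => [//|[//|q]] _ /=.
(* Here [q] is |F| - 2: outside C_0, |F|^2 - 1 points are shared equally by |F| - 1 conics. *)
have -> : (q.+2 ^ 2 = 1 + q.+1 * q.+3)%N by ring.
by move/eqP; rewrite eqn_add2l eqn_pmul2l // => /eqP.
Qed.

(* Write Q(x, y) = a x^2 + b y^2.  As Q(B) and Q(A + B) determine <A, B>,
   Lagrange's identity Q(A) Q(B) = <A, B>^2 + ab det(A, B)^2 leaves two values
   for det(A, B), which together with <A, B> determines B. *)
Lemma card_conic_shift_le2 (F : finFieldType) (a b j k : F) (A : F * F) :
  2 != 0 :> F -> a != 0 -> b != 0 -> A \notin conic a b 0 ->
  (#|[set B in conic a b j | (A + B)%R \in conic a b k]%SET| <= 2)%N.
Proof.
case: A => x y F2 a0 b0; rewrite !inE /=.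
set i := _ + _ => i0.
(* Polarization: Q(A + B) = Q(A) + Q(B) + 2<A, B>, so [s] is the value of <A, B>. *)
set s := (k - i - j) / 2.
pose d (B : F * F) := x * B.2 - y * B.1.
set S := finset _.
have SE u v : (u, v) \in S ->
    a * u ^+ 2 + b * v ^+ 2 = j /\ a * x * u + b * y * v = s.
  rewrite !inE /= => /andP[/eqP uv /eqP kE]; split => //.
  by rewrite /s -kE -uv /i; field.
(* Cramer's rule: the linear system giving <A, B> and det(A, B) has determinant Q(A) = i, which is
   nonzero. *)
have dinj : {in S &, injective d}.
  move=> [u v] [u' v'] /SE[_ l1] /SE[_ l2]; rewrite /d /= => dd.
  have uE : i * u = i * u'.
    have -> : i * u =
        x * (a * x * u + b * y * v) - b * y * (x * v - y * u).
      by rewrite /i; ring.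
    by rewrite l1 dd -l2 /i; ring.
  have vE : i * v = i * v'.
    have -> : i * v =
        y * (a * x * u + b * y * v) + a * x * (x * v - y * u).
      by rewrite /i; ring.
    by rewrite l1 dd -l2 /i; ring.
  by rewrite (mulfI i0 uE) (mulfI i0 vE).
rewrite -(card_in_imset dinj).
apply: leq_trans (card_sqr_roots_le2 _ ((i * j - s ^+ 2) / (a * b))).
apply: subset_leq_card; apply/fintype.subsetP => _ /imsetP[[u v] /SE[<- <-] ->].
by rewrite inE /d /=; apply/eqP; rewrite /i; field; rewrite a0 b0.
Qed.

(** * Bounds and marginal sums of the pair counts *)

Lemma conic_count_le (F : finFieldType) (a b i j k : F) :
  2 != 0 :> F -> a != 0 -> b != 0 -> i != 0 ->
  (conic_count a b i j k <= 2 * #|conic a b i|)%N.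
Proof.
move=> F2 a0 b0 i0.
have -> : conic_count a b i j k =
    (\sum_(A in conic a b i)
        #|[set B in conic a b j | (A + B)%R \in conic a b k]%SET|)%N.
  rewrite /conic_count -sum1_card.
  under [RHS]eq_bigr do rewrite -sum1_card.
  by rewrite pair_big_dep /=; apply: eq_bigl => -[A B]; rewrite !inE.
rewrite mulnC -sum_nat_const; apply: leq_sum => A; rewrite inE => /eqP AE.
by apply: card_conic_shift_le2 => //; rewrite inE AE.
Qed.

Lemma sum_conic_count_r (F : finFieldType) (a b i j : F) :
  (\sum_k conic_count a b i j k = #|conic a b i| * #|conic a b j|)%N.
Proof.
rewrite -cardsX -sum1_card.
rewrite (partition_big (fun P : (F * F) * (F * F) =>
  a * (P.1 + P.2).1 ^+ 2 + b * (P.1 + P.2).2 ^+ 2) xpredT) //=.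
apply: eq_bigr => k _; rewrite /conic_count -sum1_card.
by apply: eq_bigl => P; rewrite !inE /= andbA.
Qed.

Lemma sum_conic_count_l (F : finFieldType) (a b j k : F) :
  (\sum_i conic_count a b i j k = #|conic a b k| * #|conic a b j|)%N.
Proof.
pose f (P : (F * F) * (F * F)) := (P.1 - P.2, P.2).
have fI : injective f.
  move=> [A B] [A' B'] e; have /= BB' := congr1 snd e.
  by move: (congr1 fst e); rewrite /= BB' => /addIr ->.
rewrite -cardsX -(card_imset _ fI) -sum1_card.
rewrite (partition_big (fun P : (F * F) * (F * F) =>
  a * P.1.1 ^+ 2 + b * P.1.2 ^+ 2) xpredT) //=.
apply: eq_bigr => i _; rewrite /conic_count -sum1_card.
apply: eq_bigl => -[A B]; rewrite !inE /=.
have -> : ((A, B) \in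
      [set f x | x in finset.setX (conic a b k) (conic a b j)])%SET =
   (A + B \in conic a b k) && (B \in conic a b j).
  have -> : (A, B) = f (A + B, B) by rewrite /f /= addrK.
  by rewrite mem_imset // inE.
by rewrite !inE /= [RHS]andbC; congr (_ && _); rewrite andbC.
Qed.

(** * Contraction of the l1 norm by finite kernels *)

(** Triangle inequality through the constant m: |p - q| <= (m - p) + (m - q). It improves on the
    trivial bound 2 as soon as m |T| < 2. *)
Lemma l1_dist_le_of_le (R : realType) (T : finType) (m : R) (p q : T -> R) :
  (forall x, p x <= m) -> (forall x, q x <= m) ->
  \sum_x p x = 1 -> \sum_x q x = 1 ->
  \sum_x `|p x - q x| <= 2 * (m * #|T|%:R - 1).
Proof.
move=> pm qm p1 q1.
apply: (@le_trans _ _ (\sum_x ((m - p x) + (m - q x)))).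
  by apply: ler_sum => x _; have := pm x; have := qm x; rewrite ler_norml; lra.
rewrite big_split /= !sumrB p1 q1 !sumr_const mulr_natr; lra.
Qed.

Lemma l1_dist_le2 (R : realType) (T : finType) (p q : T -> R) :
  (forall x, 0 <= p x) -> (forall x, 0 <= q x) ->
  \sum_x p x = 1 -> \sum_x q x = 1 -> \sum_x `|p x - q x| <= 2.
Proof.
move=> p0 q0 p1 q1.
apply: (@le_trans _ _ (\sum_x (p x + q x))); last by rewrite big_split /= p1 q1.
apply: ler_sum => x _; apply: (le_trans (ler_normB _ _)).
by rewrite !ger0_norm.
Qed.

Lemma dobrushin_contraction (R : realType) (T : finType) (K : T -> T -> R)
    (r : R) (v : T -> R) :
  (forall x y, \sum_z `|K x z - K y z| <= 2 * r) -> \sum_x v x = 0 ->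
  \sum_z `|\sum_x v x * K x z| <= r * \sum_x `|v x|.
Proof.
move=> Kr v0.
have [p [n [p0 n0 vE nvE]]] : exists p n : T -> R,
    [/\ forall x, 0 <= p x, forall x, 0 <= n x, forall x, v x = p x - n x
      & forall x, `|v x| = p x + n x].
  exists (fun x => (`|v x| + v x) / 2), (fun x => (`|v x| - v x) / 2).
  by split=> x; have := ler_norm (v x); have := ler_norm (- v x);
    rewrite normrN; lra.
have pn : \sum_x p x = \sum_x n x.
  apply/eqP; rewrite -subr_eq0 -sumrB -{2}v0.
  by under [eqbRHS]eq_bigr do rewrite vE.
pose s := \sum_x n x.
have ps : \sum_x p x = s by [].
have s0 : 0 <= s by rewrite -ps sumr_ge0.
have sN : \sum_x `|v x| = 2 * s.
  by under eq_bigr do rewrite nvE; rewrite big_split /= ps -/s; ring.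
(* The positive part [p] and the negative part [n] have equal mass [s]. The product weights p(x)
   n(y) pair them, with total weight s^2, so the image of [v] becomes a combination of row
   differences. *)
have sE z : s * (\sum_x v x * K x z) =
    \sum_x \sum_y p x * n y * (K x z - K y z).
  have -> : \sum_x \sum_y p x * n y * (K x z - K y z) =
    \sum_x (p x * K x z * s - p x * \sum_y n y * K y z).
    apply: eq_bigr => x _; rewrite !mulr_sumr -sumrB.
    by apply: eq_bigr => y _; ring.
  set N := \sum_y n y * K y z.
  have -> : \sum_x (p x * K x z * s - p x * N) =
      (\sum_x p x * K x z) * s - (\sum_x p x) * N by rewrite sumrB !mulr_suml.
  rewrite ps [X in _ = X - _]mulrC -mulrBr -sumrB.
  congr (_ * _); apply: eq_bigr => x _.
  by rewrite vE mulrBl.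
have : s * (\sum_z `|\sum_x v x * K x z|) <= s * (r * \sum_x `|v x|).
  have -> : s * (r * \sum_x `|v x|) = \sum_x \sum_y p x * n y * (2 * r).
    under [RHS]eq_bigr do rewrite -mulr_suml -mulr_sumr -/s.
    by rewrite -!mulr_suml ps sN; ring.
  rewrite mulr_sumr.
  apply: (@le_trans _ _
      (\sum_z \sum_x \sum_y p x * n y * `|K x z - K y z|)).
    apply: ler_sum => z _; rewrite -[X in X * _]ger0_norm // -normrM sE.
    apply: (le_trans (ler_norm_sum _ _ _)); apply: ler_sum => x _.
    apply: (le_trans (ler_norm_sum _ _ _)); apply: ler_sum => y _.
    by rewrite normrM ger0_norm // mulr_ge0.
  rewrite exchange_big; apply: ler_sum => x _.
  rewrite exchange_big; apply: ler_sum => y _.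
  by rewrite -mulr_sumr ler_wpM2l // mulr_ge0.
(* The factor [s] cancels unless it is 0, and then [v] vanishes. *)
move: s0; rewrite le_eqVlt => /orP[/eqP s0|s0]; last by rewrite ler_pM2l.
have /(psumr_eq0P (fun y _ => normr_ge0 (v y))) Nv0 : \sum_x `|v x| = 0.
  by rewrite sN -s0 mulr0.
have vx x : v x = 0 by apply/eqP; rewrite -normr_eq0 Nv0.
move=> _; rewrite sN -s0 !mulr0 big1 // => z _.
by rewrite big1 ?normr0 // => x _; rewrite vx mul0r.
Qed.

(** Take independent first steps i from x and j from y. Both land in [A] with probability at least
    h^2, where the rows are within 2(1 - c). Otherwise the trivial bound 2 applies. *)
Lemma l1_dist_two_step (R : realType) (T : finType) (K : T -> T -> R)
    (A : pred T) (h c : R) :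
  (forall x y, 0 <= K x y) -> (forall x, \sum_y K x y = 1) ->
  0 <= h -> (forall x, h <= \sum_(y | A y) K x y) -> 0 <= c ->
  (forall x y, A x -> A y -> \sum_z `|K x z - K y z| <= 2 * (1 - c)) ->
  forall x y, \sum_z `|\sum_w K x w * K w z - \sum_w K y w * K w z|
    <= 2 * (1 - c * h ^+ 2).
Proof.
move=> K0 K1 h0 hA c0 Ac x y.
pose g z : R := (A z)%:R.
have gE z : \sum_w K z w * g w = \sum_(w | A w) K z w.
  rewrite [RHS]big_mkcond; apply: eq_bigr => w _.
  by rewrite /g; case: (A w); rewrite ?mulr1 ?mulr0.
have KE z : \sum_w K x w * K w z - \sum_w K y w * K w z =
    \sum_i \sum_j K x i * K y j * (K i z - K j z).
  transitivity (\sum_i (K x i * K i z - K x i * \sum_j K y j * K j z)).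
    by rewrite sumrB -mulr_suml K1 mul1r.
  apply: eq_bigr => i _; rewrite -[X in X - _]mulr1 -(K1 y) !mulr_sumr -sumrB.
  by apply: eq_bigr => j _; ring.
apply: (@le_trans _ _
    (\sum_z \sum_i \sum_j K x i * K y j * `|K i z - K j z|)).
  apply: ler_sum => z _; rewrite KE.
  apply: (le_trans (ler_norm_sum _ _ _)); apply: ler_sum => i _.
  apply: (le_trans (ler_norm_sum _ _ _)); apply: ler_sum => j _.
  by rewrite normrM ger0_norm // mulr_ge0.
apply: (@le_trans _ _
    (\sum_i \sum_j K x i * K y j * (2 - 2 * c * (g i * g j)))).
  rewrite exchange_big; apply: ler_sum => i _.
  rewrite exchange_big; apply: ler_sum => j _.
  rewrite -mulr_sumr ler_wpM2l ?mulr_ge0 // /g.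
  have [Ai|nAi] := boolP (A i); last first.
    by rewrite mul0r mulr0 subr0 l1_dist_le2.
  have [Aj|nAj] := boolP (A j); last by rewrite !mulr0 subr0 l1_dist_le2.
  apply: (le_trans (Ac i j Ai Aj)); rewrite -[true%:R]/(1 : R); lra.
have -> : \sum_i \sum_j K x i * K y j * (2 - 2 * c * (g i * g j)) =
    2 - 2 * c * ((\sum_(i | A i) K x i) * (\sum_(j | A j) K y j)).
  rewrite -!gE.
  transitivity (\sum_i (K x i * 2 -
     K x i * g i * (2 * c * \sum_j K y j * g j))).
    apply: eq_bigr => i _; rewrite -[X in X - _]mulr1 -(K1 y) !mulr_sumr -sumrB.
    by apply: eq_bigr => j _; ring.
  by rewrite sumrB -!mulr_suml K1; ring.
have : h ^+ 2 <= (\sum_(i | A i) K x i) * (\sum_(j | A j) K y j).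
  by rewrite expr2 ler_pM.
by move/(ler_wpM2l c0); lra.
Qed.

(** * Kernel powers, stationary vectors and mixing *)

Lemma kernel_pow_ge0 (R : realType) (T : finType) (K : T -> T -> R) n x y :
  (forall x y, 0 <= K x y) -> 0 <= kernel_pow K n x y.
Proof.
move=> K0; elim: n x y => [|n IH] x y /=; first exact: ler0n.
by apply: sumr_ge0 => z _; rewrite mulr_ge0.
Qed.

Lemma kernel_pow_sum1 (R : realType) (T : finType) (K : T -> T -> R) n x :
  (forall x, \sum_y K x y = 1) -> \sum_y kernel_pow K n x y = 1.
Proof.
move=> K1; elim: n => [|n IH] /=.
  rewrite (bigD1 x) //= eqxx big1 ?addr0 // => y /negPf.
  by rewrite eq_sym => ->.
rewrite exchange_big /= -[RHS]IH; apply: eq_bigr => z _.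
by rewrite -mulr_sumr K1 mulr1.
Qed.

Lemma stationary_two_step (R : realType) (T : finType) (K : T -> T -> R)
    (pi : {ffun T -> R}) y :
  stationary K pi -> \sum_w pi w * \sum_z K w z * K z y = pi y.
Proof.
move=> [_ _ piK]; under eq_bigr do rewrite mulr_sumr.
rewrite exchange_big /= -[RHS]piK; apply: eq_bigr => z _.
by rewrite -piK mulr_suml; apply: eq_bigr => w _; rewrite mulrA.
Qed.

(** The difference of two stationary vectors has sum zero and is fixed by K^2, which contracts it by
    1 - d. *)
Lemma stationary_unique (R : realType) (T : finType) (K : T -> T -> R) (d : R)
    (pi pi' : {ffun T -> R}) : 0 < d ->
  (forall x y, \sum_z `|\sum_w K x w * K w z - \sum_w K y w * K w z|
     <= 2 * (1 - d)) ->
  stationary K pi -> stationary K pi' -> pi' = pi.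
Proof.
move=> d0 Kd pis pis'.
have s0 : \sum_x (pi' x - pi x) = 0.
  by case: pis pis' => [_ p1 _] [_ p1' _]; rewrite sumrB p1 p1' subrr.
have := dobrushin_contraction _ _ _ _ _ Kd s0.
have -> : \sum_z `|\sum_x (pi' x - pi x) * (\sum_w K x w * K w z)| =
   \sum_z `|pi' z - pi z|.
  apply: eq_bigr => z _.
  by rewrite -(stationary_two_step _ _ _ _ z pis)
    -(stationary_two_step _ _ _ _ z pis') -sumrB;
    congr `| _ |; apply: eq_bigr => x _; rewrite mulrBl.
set e := \sum_z _ => ee.
have e0 : 0 <= e by apply: sumr_ge0.
have {}e0 : e = 0.
  have : d * e <= 0 by lra.
  by rewrite pmulr_rle0 //; lra.
apply/ffunP => x; apply/eqP; rewrite -subr_eq0 -normr_eq0; apply/eqP.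
by move/(psumr_eq0P (fun y _ => normr_ge0 _)): e0 => ->.
Qed.

(** A harmonic bound, weaker than geometric decay, but one that tends to 0 and whose crossing time
    of any level is linear in 1/d. Since the contraction relates n to n + 2, the induction carries
    two consecutive times. *)
Lemma dTV_kernel_pow_le (R : realType) (T : finType) (K : T -> T -> R) (d : R)
    (pi : {ffun T -> R}) n x :
  (forall x y, 0 <= K x y) -> (forall x, \sum_y K x y = 1) ->
  0 < d <= 1 ->
  (forall x y, \sum_z `|\sum_w K x w * K w z - \sum_w K y w * K w z|
     <= 2 * (1 - d)) ->
  stationary K pi -> dTV (kernel_pow K n x) pi <= 2 / (d * n.+1%:R).
Proof.
move=> K0 K1 /andP[d0 d1] Kd pis; have [pi0 pi1 _] := pis.
pose e n := \sum_y `|kernel_pow K n x y - pi y|.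
have e2 m : e m <= 2.
  apply: l1_dist_le2 => // [y|]; first exact: kernel_pow_ge0.
  exact: kernel_pow_sum1.
have eS m : e m.+2 <= (1 - d) * e m.
  have s0 : \sum_y (kernel_pow K m x y - pi y) = 0.
    by rewrite sumrB kernel_pow_sum1 // pi1 subrr.
  apply: le_trans (dobrushin_contraction _ _ _ _ _ Kd s0).
  rewrite le_eqVlt; apply/orP; left; apply/eqP; apply: eq_bigr => z _.
  rewrite -{1}(stationary_two_step _ _ _ _ z pis) /=.
  under [in RHS]eq_bigr do rewrite mulrBl.
  rewrite sumrB; congr `| _ - _ |.
  under eq_bigr do rewrite mulr_suml.
  rewrite exchange_big; apply: eq_bigr => w _ /=.
  by rewrite mulr_sumr; apply: eq_bigr => y _; rewrite mulrA.
(* The bound is the inequality (1 - d) / A <= 1 / (A + d) for A >= 1 - d. *)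
have key m : e m * (2 - d + d * m%:R) <= 4 /\
    e m.+1 * (2 - d + d * m.+1%:R) <= 4.
  elim: m => [|m [IH IH1]].
    have := e2 0%N; have := e2 1%N.
    by split; [rewrite mulr0|rewrite mulr1]; nra.
  split => //; apply: le_trans IH.
  have m0 : 0 <= m%:R :> R by [].
  have em0 : 0 <= e m by apply: sumr_ge0.
  have dm : 0 <= d * m%:R by rewrite mulr_ge0 // ltW.
  apply: (@le_trans _ _ ((1 - d) * e m * (2 - d + d * m.+2%:R))).
    by apply: ler_wpM2r (eS m); rewrite -addn2 natrD; nra.
  rewrite mulrAC mulrC ler_wpM2l //.
  by rewrite -addn2 natrD; nra.
have n0 : 0 < n.+1%:R :> R by rewrite ltr0n.
(* As d <= 1, the factor 2 - d + d n is at least d (n + 1). *)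
rewrite ler_pdivlMr ?mulr_gt0 // /dTV -/(e n).
have [+ _] := key n; have en0 : 0 <= e n by apply: sumr_ge0.
by rewrite -(natr1 n); nra.
Qed.

Lemma mixing_time_le (R : realType) (T : finType) (K : T -> T -> R)
    (pi : T -> R) (eps s : R) (t : nat) :
  (forall x, dTV (kernel_pow K t x) pi <= eps) -> t%:R <= s ->
  (mixing_time K pi eps <= s%:E)%E.
Proof.
move=> dt ts; apply: bigmax_le => [|x _]; first exact: leNye.
apply: ge_ereal_inf; exists (t%:R)%:E; last by rewrite lee_fin.
by exists t => //; exact: dt.
Qed.

(** * The walk on the conics *)

Lemma conic_walk_ge0 (R : realType) (F : finFieldType) (a b i j : F) :
  0 <= conic_walk R a b i j.
Proof. by rewrite divr_ge0. Qed.

Lemma conic_walk_sum1 (R : realType) (F : finFieldType) (a b c i : F) :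
  (#|F| %% 4 = 3)%N -> a != 0 -> c != 0 -> a * b = c ^+ 2 ->
  \sum_j conic_walk R a b i j = 1.
Proof.
move=> F3 a0 c0 abc; rewrite -mulr_suml -natr_sum sum_conic_count_r divff //.
rewrite pnatr_eq0 muln_eq0 !(card_conic _ _ _ _ _ F3 a0 c0 abc) oner_eq0.
by case: (i == 0).
Qed.

Lemma conic_walk_le (R : realType) (F : finFieldType) (a b c i j : F) :
  (#|F| %% 4 = 3)%N -> a != 0 -> b != 0 -> c != 0 -> a * b = c ^+ 2 ->
  i != 0 -> conic_walk R a b i j <= 2 / #|F|.+1%:R.
Proof.
move=> F3 a0 b0 c0 abc i0; rewrite /conic_walk /conic_coef.
have := conic_count_le _ a b i 1 j (card_mod4_eq3_2neq0 _ F3) a0 b0 i0.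
rewrite !(card_conic _ _ _ _ _ F3 a0 c0 abc) oner_eq0 (negPf i0).
rewrite -(ler_nat R) !natrM => h.
rewrite invfM mulrA ler_wpM2r ?invr_ge0 ?ler0n //.
by rewrite ler_pdivrMr ?ltr0n.
Qed.

(** For i <> 0 the bound 2/(q+1) is at most 1/2 because q >= 3. From C_0, which is the origin alone,
    the walk goes to C_1. *)
Lemma conic_walk_to0_le (R : realType) (F : finFieldType) (a b c i : F) :
  (#|F| %% 4 = 3)%N -> a != 0 -> b != 0 -> c != 0 -> a * b = c ^+ 2 ->
  conic_walk R a b i 0 <= 1 / 2.
Proof.
move=> F3 a0 b0 c0 abc; have [->|i0] := eqVneq i 0.
  rewrite /conic_walk /conic_coef.
  have -> : conic_count a b 0 1 0 = 0%N.
    apply/eqP; rewrite cards_eq0; apply/eqP/setP => -[A B].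
    rewrite inE /= (conic0 _ _ _ _ F3 a0 c0 abc) !inE; apply/negP.
    move=> /and3P[/eqP -> /eqP B1]; rewrite add0r => /eqP B0.
    move: B1; rewrite B0 /= expr0n /= !mulr0 addr0 => /eqP.
    by rewrite eq_sym oner_eq0.
  by rewrite mul0r divr_ge0.
apply: le_trans (conic_walk_le _ _ _ _ _ _ _ F3 a0 b0 c0 abc i0) _.
have q3 : (3 <= #|F|)%N by rewrite -F3 leq_mod.
have {q3} : 4 <= #|F|.+1%:R :> R by rewrite ler_nat.
by move=> q4; rewrite ler_pdivrMr; lra.
Qed.

Lemma conic_walk_two_step (R : realType) (F : finFieldType) (a b c x y : F) :
  (#|F| %% 4 = 3)%N -> a != 0 -> b != 0 -> c != 0 -> a * b = c ^+ 2 ->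
  \sum_z `|\sum_w conic_walk R a b x w * conic_walk R a b w z -
           \sum_w conic_walk R a b y w * conic_walk R a b w z|
    <= 2 * (1 - (2 * #|F|.+1%:R)^-1).
Proof.
move=> F3 a0 b0 c0 abc; set K := conic_walk R a b.
have K1 z : \sum_w K z w = 1 := conic_walk_sum1 _ _ _ _ _ _ F3 a0 c0 abc.
have q0 : 0 < #|F|.+1%:R :> R by rewrite ltr0n.
(* The two-step estimate is used with c = 2/(q+1), h = 1/2 and the nonzero states as target set. *)
have -> : (2 * #|F|.+1%:R)^-1 = 2 / #|F|.+1%:R * (1 / 2) ^+ 2 :> R.
  by move: q0; set q := _%:R => q0; field; rewrite gt_eqF.
apply: (l1_dist_two_step _ _ _ (fun z => z != 0)) => //.
- exact: conic_walk_ge0.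
- move=> z; have := K1 z; rewrite (bigD1 0) //=.
  by have := conic_walk_to0_le R _ _ _ _ z F3 a0 b0 c0 abc; rewrite -/K; lra.
- move=> i j i0 j0.
  have := l1_dist_le_of_le _ _ _ _ _
    (fun k => conic_walk_le R _ _ _ _ _ k F3 a0 b0 c0 abc i0)
    (fun k => conic_walk_le R _ _ _ _ _ k F3 a0 b0 c0 abc j0) (K1 i) (K1 j).
  move/le_trans; apply; rewrite le_eqVlt; apply/orP; left; apply/eqP.
  by rewrite -(natr1 #|F|); field; rewrite natr1 pnatr_eq0.
Qed.

(** The law of a x^2 + b y^2 at a uniformly random point of the plane. *)
Definition conic_dist (R : realType) (F : finFieldType) (a b : F) :
  {ffun F -> R} := [ffun i => #|conic a b i|%:R / #|F|%:R ^+ 2].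

Lemma conic_dist_stationary (R : realType) (F : finFieldType) (a b c : F) :
  (#|F| %% 4 = 3)%N -> a != 0 -> c != 0 -> a * b = c ^+ 2 ->
  stationary (conic_walk R a b) (conic_dist R F a b).
Proof.
move=> F3 a0 c0 abc.
have C0 i : #|conic a b i|%:R != 0 :> R.
  by rewrite pnatr_eq0 (card_conic _ _ _ _ _ F3 a0 c0 abc); case: (i == 0).
have q0 : #|F|%:R != 0 :> R by rewrite pnatr_eq0 -lt0n (ltnW (finNzRing_gt1 F)).
split=> [i||k]; first by rewrite ffunE divr_ge0.
  under eq_bigr do rewrite ffunE.
  by rewrite -mulr_suml -natr_sum sum_card_conic natrX divff // expf_neq0.
rewrite ffunE.
transitivity (\sum_i (conic_count a b i 1 k)%:R /
    (#|conic a b 1|%:R * #|F|%:R ^+ 2) :> R).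
  apply: eq_bigr => i _; rewrite ffunE /conic_walk /conic_coef natrM.
  by field; rewrite q0 !C0.
rewrite -mulr_suml -natr_sum sum_conic_count_l natrM.
by field; rewrite q0 C0.
Qed.

Lemma conic_walk_dTV_le (R : realType) (F : finFieldType) (a b c : F) n x :
  (#|F| %% 4 = 3)%N -> a != 0 -> b != 0 -> c != 0 -> a * b = c ^+ 2 ->
  dTV (kernel_pow (conic_walk R a b) n x) (conic_dist R F a b) <=
    4 * #|F|.+1%:R / n.+1%:R.
Proof.
move=> F3 a0 b0 c0 abc.
have -> : 4 * #|F|.+1%:R / n.+1%:R =
    2 / ((2 * #|F|.+1%:R)^-1 * n.+1%:R) :> R.
  by rewrite invfM invrK !mulrA -(natrM _ 2 2).
apply: dTV_kernel_pow_le.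
- exact: conic_walk_ge0.
- by move=> i; apply: conic_walk_sum1 F3 a0 c0 abc.
- rewrite invr_gt0 mulr_gt0 ?ltr0n //= invf_le1 ?mulr_gt0 ?ltr0n //.
  by rewrite -natrM ler1n.
- by move=> i j; apply: conic_walk_two_step F3 a0 b0 c0 abc.
- exact: conic_dist_stationary F3 a0 c0 abc.
Qed.

(** * The limit and the mixing time *)

Lemma cvg_alpha (R : realType) (F : finFieldType) (a b c i : F) :
  (#|F| %% 4 = 3)%N -> a != 0 -> b != 0 -> c != 0 -> a * b = c ^+ 2 ->
  (fun n : nat => alpha R a b n i) @ \oo --> conic_dist R F a b i.
Proof.
move=> F3 a0 b0 c0 abc; apply/subr_cvg0.
(* A single coordinate differs by at most the l1 distance, which is twice d_TV; hence 8 instead of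
   4. *)
pose C : R := 8 * #|F|.+1%:R.
apply: norm_cvg0.
apply: (@squeeze_cvgr _ _ _ _ (fun=> 0) (fun n => C * harmonic n));
  last 2 first.
- exact: cvg_cst.
- by rewrite -(mulr0 C); apply: cvgMr; exact: cvg_harmonic.
apply: nearW => n; rewrite normr_ge0 /=.
have := conic_walk_dTV_le R _ _ _ _ n 0 F3 a0 b0 c0 abc.
rewrite /dTV (bigD1 i) //= alphaE.
set s := \sum_(_ | _) _ => h.
have s0 : 0 <= s by apply: sumr_ge0.
rewrite /C /harmonic -mulrA; move: h s0; rewrite -mulrA.
by set w := _ / n.+1%:R; lra.
Qed.

Theorem theorem4 (R : realType) :
  (forall (F : finFieldType) (a b c : F),
      (#|F| %% 4 = 3)%N -> a != 0 -> b != 0 -> c != 0 -> a * b = c ^+ 2 ->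
      ((fun n : nat => alpha R a b n 0) @ \oo --> 1 / (#|F|%:R ^+ 2 : R)) /\
      (forall i : F, i != 0 ->
         (fun n : nat => alpha R a b n i) @ \oo -->
           (#|F|%:R + 1) / (#|F|%:R ^+ 2 : R)))
  /\
  (forall eps : R, 0 < eps -> eps < 1 ->
     exists M : R,
       forall (F : finFieldType) (a b c : F),
         (#|F| %% 4 = 3)%N -> a != 0 -> b != 0 -> c != 0 -> a * b = c ^+ 2 ->
         exists pi : {ffun F -> R},
           [/\ stationary (conic_walk R a b) pi,
               (forall pi' : {ffun F -> R},
                  stationary (conic_walk R a b) pi' -> pi' = pi)
             & (mixing_time (conic_walk R a b) pi eps <= (M * #|F|%:R)%:E)%E]).
Proof.
split=> [F a b c F3 a0 b0 c0 abc|eps eps0 _].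
  have cvg i := cvg_alpha R _ _ _ _ i F3 a0 b0 c0 abc.
  split=> [|i i0]; [have := cvg 0|have := cvg i];
    rewrite ffunE (card_conic _ _ _ _ _ F3 a0 c0 abc).
    by rewrite eqxx.
  by rewrite (negPf i0) natr1.
(* The time needed is about 4(q+1)/eps, and q + 1 <= 2q. *)
exists (8 / eps) => F a b c F3 a0 b0 c0 abc; exists (conic_dist R F a b).
have pis := conic_dist_stationary R _ _ _ _ F3 a0 c0 abc.
split=> // [pi'|].
  apply: (stationary_unique _ _ _ (2 * #|F|.+1%:R)^-1) pis.
    by rewrite invr_gt0 mulr_gt0 ?ltr0n.
  by move=> x y; exact: conic_walk_two_step F3 a0 b0 c0 abc.
pose T : R := 4 * #|F|.+1%:R / eps.
have T0 : 0 <= T by rewrite divr_ge0 ?mulr_ge0 ?ler0n // ltW.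
(* With n the integer part of [T], n <= T < n + 1: the upper bound brings 4(q+1)/(n+1) below eps,
   the lower one bounds the time. *)
have /andP[tT Tt] := truncn_itv T0.
apply: (mixing_time_le _ _ _ _ _ _ (Num.trunc T)) => [x|].
  apply: le_trans (conic_walk_dTV_le R _ _ _ _ _ x F3 a0 b0 c0 abc) _.
  by rewrite ler_pdivrMr ?ltr0n // -ler_pdivrMl // mulrC ltW.
apply: (le_trans tT).
rewrite /T [leRHS]mulrAC ler_wpM2r ?invr_ge0 ?(ltW eps0) //.
have : 1 <= #|F|%:R :> R by rewrite ler1n (ltnW (finNzRing_gt1 F)).
by rewrite -(natr1 #|F|); lra.
Qed.
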